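(* In the standing setting described in the context (all parameters $c,m,q,\alpha,p$ fixed), let $R,\widetilde R:\mathbb R\to(R_-,R_+)$ be two global profiles connecting $R_-$ to $R_+$ in the sense defined in the context. Then there exists $\xi_0\in\mathbb R$ such that $$\widetilde R(\xi)=R(\xi-\xi_0)\qquad(\xi\in\mathbb R).$$ If both profiles are normalized by the phase condition $R(0)=\widetilde R(0)=R_s$, then $\widetilde R\equiv R$.
   Context: Standing setting. Fix $\alpha>0$, a physical equation of state $\tilde p:(0,\infty)\times\mathbb R\to\mathbb R$, $(\rho,e)\mapsto\tilde p(\rho,e)$, of class $C^2$, real numbers $c,m,q,k$ with $m\neq0$, and end states $R_\pm>0$, $U_\pm,\mathcal E_\pm\in\mathbb R$. Put $e_\pm=\mathcal E_\pm/R_\pm-\frac12U_\pm^2$ and assume the Rankine–Hugoniot relations $R_\pm(U_\pm-c)=m$, $mU_\pm+\tilde p(R_\pm,e_\pm)=q$, $(\mathcal E_\pm+\tilde p(R_\pm,e_\pm))U_\pm-c\,\mathcal E_\pm=k$. For $R>0$ define $$e(R)=e_0+\frac{A}{R}+\frac{m^2}{2R^2},\quad e_0=\frac{k-qc+\frac m2c^2}{m},\quad A=mc-q,$$ the reduced pressure $p(R)=\tilde p(R,e(R))$, and $\mathcal S(R)=q-mc-\frac{m^2}{R}-p(R)$. (Then $e(R_\pm)=e_\pm$ and $\mathcal S(R_\pm)=0$.) Primes denote $d/dR$, dots denote $d/d\xi$. Assume: (1) $R_-<R_+$; (2) Lax inequalities: $U_--\sqrt{p'(R_-)}>c>U_+-\sqrt{p'(R_+)}$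 (with $p'(R_\pm)\ge0$); equivalently $m>0$, $\frac{m^2}{R_-^2}-p'(R_-)>0$ and $\frac{m^2}{R_+^2}-p'(R_+)<0$; (3) $p\in C^2((0,\infty))$, and one of the following convexity criteria holds along $(\rho,e)=(R,e(R))$ for $R\in[R_-,R_+]$: (A) the matrix $\begin{pmatrix}\tilde p_{\rho\rho}+\frac{m^2}{R^4}\tilde p_e&\tilde p_{\rho e}-\frac1R\tilde p_e\\ \tilde p_{\rho e}-\frac1R\tilde p_e&\tilde p_{ee}\end{pmatrix}$ is positive semidefinite; or (B) $\tilde p_{\rho\rho}\ge0$, $\tilde p_{ee}\ge0$, $\tilde p_e\ge0$, $\tilde p_{\rho e}\ge\frac1R\tilde p_e$, $e'(R)\ge0$. In particular $p''(R)\ge0$, and this inequality is assumed for all $R>0$; (4) $p''$ is Lipschitz in a neighborhood of $R_s$, where the sonic density $R_s\in(R_-,R_+)$ is the unique zero of $\mathcal S'$ in $(0,\infty)$. Canonical one-sided solutions. With $P(R)=-\frac2R-\frac{2p''(R)}{\mathcal S'(R)}$ and $Q(R)=\frac2\alpha\frac{\mathcal S(R)}{\mathcal S'(R)}$, $Z_-$ is the unique function in $C^1((R_-,R_s))\cap C^0([R_-,R_s))$ with $Z_-'+PZ_-=Q$ on $(R_-,R_s)$ and $Z_-(R_-)=0$; $Z_+$ is the unique function in $C^1((R_s,R_+))\cap C^0((R_s,R_+])$ with $Z_+'+PZ_+=Q$ on $(R_s,R_+)$ and $Z_+(R_+)=0$. A global profile connecting $R_-$ to $R_+$ is a continuous strictly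 increasing function $R:\mathbb R\to(R_-,R_+)$ for which there is a point $\xi_s\in\mathbb R$ such that: $R(\xi_s)=R_s$ and $R$ is $C^2$ on $(-\infty,\xi_s)\cup(\xi_s,\infty)$; $\dot R^2=Z_-(R)$ on $(-\infty,\xi_s)$ and $\dot R^2=Z_+(R)$ on $(\xi_s,\infty)$; $R(\xi)\to R_\pm$ and $\dot R(\xi)\to0$ as $\xi\to\pm\infty$; and $R\in W^{1,2}_{\mathrm{loc}}(\mathbb R)$ satisfies, for every $\varphi\in C_c^\infty(\mathbb R)$, $\int_{\mathbb R}\alpha\frac{\mathcal S'(R)}{R}\dot R\,\dot\varphi\,d\xi+\int_{\mathbb R}\big(\frac{\mathcal S(R)}{R}-2\alpha\frac{m^2}{R^4}\dot R^2\big)\varphi\,d\xi=0$. *)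

(* Defs.v *)
From HB Require Import structures.
From mathcomp Require Import all_boot all_order all_algebra.
From mathcomp Require Import all_classical all_reals all_analysis.
Import Order.TTheory GRing.Theory Num.Theory.
Import numFieldNormedType.Exports.

Set Implicit Arguments.
Unset Strict Implicit.
Unset Printing Implicit Defensive.

Local Open Scope classical_set_scope.
Local Open Scope ring_scope.

(* In [ring_scope] these denote formal derivatives of polynomials; here they
   are the derivatives of functions. *)
Local Notation "f ^` ()" := (derive1 f) : ring_scope.
Local Notation "f ^` ( n )" := (derive1n n f) : ring_scope.

Section Regularity.
Context {R : realType}.
Implicit Types (A : set R) (f g phi : R -> R) (F : R -> R -> R).

(* The C^1/C^2 predicates below are meant for open sets. *)
Definition C1_on A f : Prop :=
  (forall x, A x -> derivable f x 1) /\
  (forall x, A x -> {for x, continuous f^`()}).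

Definition C2_on A f : Prop := C1_on A f /\ C1_on A f^`().

Definition partial1 F : R -> R -> R := fun x y => (F ^~ y)^`() x.
Definition partial2 F : R -> R -> R := fun x y => (F x)^`() y.

Definition C1_on2 (D : set (R * R)) F : Prop :=
  [/\ forall x y, D (x, y) -> derivable (F ^~ y) x 1,
      forall x y, D (x, y) -> derivable (F x) y 1,
      forall z, D z -> {for z, continuous (uncurry (partial1 F))} &
      forall z, D z -> {for z, continuous (uncurry (partial2 F))}].

Definition C2_on2 (D : set (R * R)) F : Prop :=
  [/\ C1_on2 D F, C1_on2 D (partial1 F) & C1_on2 D (partial2 F)].

Definition test_function phi : Prop :=
  (forall n x, derivable (phi^`(n)) x 1) /\
  compact (closure [set x | phi x != 0]).

Local Notation mu := (@lebesgue_measure R).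

Definition L2_loc f : Prop :=
  measurable_fun setT f /\ locally_integrable setT (fun x => f x ^+ 2).

Definition weak_derivative f g : Prop :=
  forall phi, test_function phi ->
    \int[mu]_x (f x * phi^`() x) = - \int[mu]_x (g x * phi x).

(* [f] is in W^{1,2}_loc, with weak derivative [g] *)
Definition W12_loc f g : Prop :=
  [/\ L2_loc f, L2_loc g & weak_derivative f g].

Definition psd n (M : 'M[R]_n) : Prop :=
  M^T = M /\ forall v : 'cV[R]_n, 0 <= (v^T *m M *m v) 0 0.

Definition mx22 (a b c d : R) : 'M[R]_2 :=
  block_mx a%:M b%:M c%:M (d%:M : 'M[R]_1).

End Regularity.

Section Reduction.
Context {R : realType}.
Variables (pt : R -> R -> R) (c m q k : R).

Definition end_energy (R0 U0 E0 : R) : R := E0 / R0 - U0 ^+ 2 / 2.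

Definition rankine_hugoniot (R0 U0 E0 : R) : Prop :=
  let pr := pt R0 (end_energy R0 U0 E0) in
  [/\ R0 * (U0 - c) = m, m * U0 + pr = q & (E0 + pr) * U0 - c * E0 = k].

Definition energy (r : R) : R :=
  (k - q * c + m / 2 * c ^+ 2) / m + (m * c - q) / r
    + m ^+ 2 / (2 * r ^+ 2).

Definition pressure (r : R) : R := pt r (energy r).

Definition Sfun (r : R) : R := q - m * c - m ^+ 2 / r - pressure r.

Local Notation p_e := (partial2 pt).
Local Notation p_rhorho := (partial1 (partial1 pt)).
Local Notation p_rhoe := (partial2 (partial1 pt)).
Local Notation p_ee := (partial2 (partial2 pt)).

Definition convexityA (r : R) : Prop :=
  let e := energy r in
  let b := p_rhoe r e - p_e r e / r in
  psd (mx22 (p_rhorho r e + m ^+ 2 / r ^+ 4 * p_e r e) b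
            b                                          (p_ee r e)).

Definition convexityB (r : R) : Prop :=
  let e := energy r in
  [/\ 0 <= p_rhorho r e, 0 <= p_ee r e, 0 <= p_e r e,
      p_e r e / r <= p_rhoe r e & 0 <= energy^`() r].

Definition Pcoef (r : R) : R :=
  - (2 / r) - 2 * pressure^`()^`() r / Sfun^`() r.

Definition Qcoef (alpha r : R) : R := 2 / alpha * (Sfun r / Sfun^`() r).

(* The values of [Z] outside [Rm, Rs[ (resp. ]Rs, Rp]) are irrelevant. *)
Definition canonical_left (alpha Rm Rs : R) (Z : R -> R) : Prop :=
  [/\ C1_on `]Rm, Rs[ Z, {within `[Rm, Rs[, continuous Z},
      forall r, r \in `]Rm, Rs[ ->
        Z^`() r + Pcoef r * Z r = Qcoef alpha r & Z Rm = 0].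

Definition canonical_right (alpha Rs Rp : R) (Z : R -> R) : Prop :=
  [/\ C1_on `]Rs, Rp[ Z, {within `]Rs, Rp], continuous Z},
      forall r, r \in `]Rs, Rp[ ->
        Z^`() r + Pcoef r * Z r = Qcoef alpha r & Z Rp = 0].

Local Notation mu := (@lebesgue_measure R).

(* [dr] is a weak derivative of the profile [r] *)
Definition weak_profile_eq (alpha : R) (r dr : R -> R) : Prop :=
  forall phi, test_function phi ->
    \int[mu]_x (alpha * (Sfun^`() (r x) / r x) * dr x * phi^`() x)
    + \int[mu]_x ((Sfun (r x) / r x
                   - 2 * alpha * (m ^+ 2 / r x ^+ 4) * dr x ^+ 2) * phi x)
    = 0.

Definition global_profile (alpha Rm Rs Rp : R) (Zm Zp r : R -> R) : Prop :=
  [/\ continuous r, {homo r : x y / x < y}, forall x, Rm < r x < Rp &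
  exists xs : R,
  [/\ r xs = Rs /\ C2_on (`]-oo, xs[ `|` `]xs, +oo[) r,
      (forall x, x < xs -> r^`() x ^+ 2 = Zm (r x)) /\
      (forall x, xs < x -> r^`() x ^+ 2 = Zp (r x)),
      (r x @[x --> -oo] --> Rm) /\ (r x @[x --> +oo] --> Rp),
      (r^`() x @[x --> -oo] --> 0) /\ (r^`() x @[x --> +oo] --> 0) &
      exists2 dr, W12_loc r dr & weak_profile_eq alpha r dr]].

End Reduction.

(* Main.v *)
(* A zero of Z_- on (R_-, R_s), or of Z_+ on (R_s, R_+), in the range of a
   profile would be a minimum, hence a zero of Q and of S; Rolle excludes this,
   since S(R_-) = S(R_+) = 0 and S' vanishes only at R_s. Both profiles thus solve
   the same autonomous equation with positive speed off the sonic point, so they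
   differ by a translation on each side, and continuity at R_s makes the two
   translations equal. *)
Require Import Defs.
From HB Require Import structures.
From mathcomp Require Import all_boot all_order all_algebra.
From mathcomp Require Import ring.
From mathcomp Require Import all_classical all_reals all_analysis.
Import Order.TTheory GRing.Theory Num.Theory.
Import numFieldNormedType.Exports.

Set Implicit Arguments.
Unset Strict Implicit.
Unset Printing Implicit Defensive.

Local Open Scope classical_set_scope.
Local Open Scope ring_scope.

(** * Rolle-type facts, and scalar linear and autonomous equations on the line *)

Section Analysis.
Context {R : realType}.
Implicit Types (f g r rt Z v : R -> R) (a b x xs xt y : R).

(** The endpoints need only continuity, so a segment may end at the sonic point, where the
    derivative of a profile is not controlled. *)
Lemma eq_of_derive0_segment f a b : a <= b ->
  {within `[a, b], continuous f} ->
  (forall x, x \in `]a, b[ -> is_derive x 1 f 0) -> f a = f b.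
Proof.
move=> ab fc df; have [d _ /eqP] := MVT_segment ab df fc.
by rewrite mul0r subr_eq0 => /eqP.
Qed.

Lemma neq_of_derive_neq0 f a b : a < b ->
  (forall x, x \in `[a, b] -> derivable f x 1) ->
  (forall x, x \in `]a, b[ -> derive1 f x != 0) -> f a != f b.
Proof.
move=> ab df nz; apply/eqP => fab.
have [d dab Dd] : exists2 d, d \in `]a, b[ & is_derive d 1 f 0.
  apply: Rolle => // [x xab|]; first exact/df/subset_itv_oo_cc.
  by apply: derivable_within_continuous => x; exact: df.
by move: (nz d dab); rewrite derive1E derive_val eqxx.
Qed.

(* A zero of [Z] would be a minimum, where the equation reads [Q = 0]. *)
Lemma linear_ode_gt0 (P Q Z : R -> R) a b :
  (forall x, x \in `]a, b[ -> derivable Z x 1) ->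
  (forall x, x \in `]a, b[ -> derive1 Z x + P x * Z x = Q x) ->
  (forall x, x \in `]a, b[ -> Q x != 0) ->
  (forall x, x \in `]a, b[ -> 0 <= Z x) ->
  forall x, x \in `]a, b[ -> 0 < Z x.
Proof.
move=> dZ ode Q0 Z0 x xab; rewrite lt_neqAle Z0// andbT; apply/eqP => Zx.
have Dx : is_derive x 1 Z 0.
  apply: (@derive1_at_min _ Z a b) => //; last by move=> t tab; rewrite -Zx Z0.
  by move: xab; rewrite in_itv/= => /andP[ax xb]; exact/ltW/(lt_trans ax).
move: (Q0 x xab); rewrite -ode// -Zx mulr0 addr0 derive1E.
by rewrite derive_val eqxx.
Qed.

Lemma continuous_surj_itv r a b : continuous r ->
  r x @[x --> -oo] --> a -> r x @[x --> +oo] --> b ->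
  forall y, a < y < b -> exists x, r x = y.
Proof.
move=> rc ra rb y /andP[ay yb].
have [x1 x1y] : exists x, r x < y.
  have [M [_ HM]] := cvgr_lt _ ra _ ay.
  by exists (M - 1); apply: HM; rewrite ltrBlDr ltrDl.
have [x2 x2y] : exists x, y < r x.
  have [M [_ HM]] := cvgr_gt _ rb _ yb.
  by exists (M + 1); apply: HM; rewrite ltrDl.
(* Monotonicity is not assumed, so the two points may come in either order. *)
have [x12|x21] := leP x1 x2.
- have [x _ <-] : exists2 x, x \in `[x1, x2] & r x = y.
    apply: IVT => //; first exact: continuous_subspaceT.
    by rewrite ge_min le_max (ltW x1y) (ltW x2y) orbT.
  by exists x.
- have [x _ <-] : exists2 x, x \in `[x2, x1] & r x = y.
    apply: IVT => //; [exact: ltW|exact: continuous_subspaceT|].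
    by rewrite ge_min le_max (ltW x1y) (ltW x2y) orbT.
  by exists x.
Qed.

(* With [g] the inverse of [rt], the function [g \o r] has slope 1 off [xs] and
   is continuous at [xs], so it is a translation. *)
Lemma autonomous_ode_translate v r rt xs xt :
  continuous r -> continuous rt -> injective r -> injective rt ->
  r xs = rt xt -> (forall x, exists y, rt y = r x) ->
  (forall x, x != xs -> is_derive x 1 r (v (r x))) ->
  (forall x, x != xt -> is_derive x 1 rt (v (rt x))) ->
  (forall x, x != xs -> v (r x) != 0) ->
  forall x, r x = rt (x + (xt - xs)).
Proof.
move=> rc rtc rI rtI rs surj dr drt vn0.
(* The default 0 is taken only off the range of [rt]; [surj] keeps every value of [r] inside it. *)
pose g y := xget 0 [set x | rt x = y].
have gK : cancel rt g.
  by move=> x; apply/rtI; apply: (@xgetPex _ 0 [set y | rt y = rt x]); exists x.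
have rtg x : rt (g (r x)) = r x by exact: (@xgetPex _ 0 [set y | rt y = r x] (surj x)).
have nK x : {near x, cancel rt g} by near=> y; exact: gK.
have nC x : \near x, {for x, continuous rt} by near=> y; exact: rtc.
have gc x : {for r x, continuous g}.
  by rewrite -rtg; exact: (nbhs_singleton (near_can_continuous (nK _) (nC _))).
pose h x := g (r x) - x.
have hc : continuous h.
  move=> x; apply: cvgB; last exact: cvg_id.
  exact: (continuous_comp (rc x) (gc x)).
have dh x : x != xs -> is_derive x 1 h 0.
  move=> xxs.
  (* The equation for [rt] is needed at [g (r x)], to differentiate the inverse there. *)
  have gx : g (r x) != xt.
    by apply: contra_neq xxs => gxt; apply: rI; rewrite rs -gxt rtg.
  have dg : is_derive (r x) 1 g (v (r x))^-1.
    rewrite -[X in is_derive X]rtg.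
    apply: is_derive_inverse (nK _) (nC _) _ (vn0 _ xxs).
    by rewrite -[X in v X]rtg; exact: drt.
  (* By the chain rule, [g \o r] has slope [(v (r x))^-1 * v (r x) = 1]. *)
  have := is_deriveB (is_derive1_comp dg (dr x xxs)) (is_derive_id x 1).
  by rewrite mulVf ?subrr// vn0.
suff hE x : h x = xt - xs.
  by move=> x; rewrite -(hE x) /h addrCA subrr addr0 rtg.
have <- : h xs = xt - xs by rewrite /h rs gK.
have hw a b : {within `[a, b], continuous h} by exact: continuous_subspaceT.
(* On either side, [h] is constant up to and including [xs]. *)
have [xxs|xsx] := leP x xs.
- apply: eq_of_derive0_segment => // y; rewrite in_itv/= => /andP[_ yxs].
  by apply: dh; rewrite lt_eqF.
- apply/esym/eq_of_derive0_segment => //; first exact: ltW.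
  by move=> y; rewrite in_itv/= => /andP[yxs _]; apply: dh; rewrite gt_eqF.
Unshelve. all: by end_near. Qed.

End Analysis.

(** * The reduced function [Sfun]: zeros at the end states and differentiability *)

Section Reduced.
Context {R : realType}.
Variables (pt : R -> R -> R) (c m q k : R).

(** The energy relation identifies [energy] at [R0] with the end energy; mass and momentum then give
    [m * (U0 - c) - m ^+ 2 / R0 = 0]. As [m = R0 * (U0 - c)], the condition [m != 0] allows division
    by [U0 - c]. *)
Lemma Sfun_end_state (R0 U0 E0 : R) : m != 0 -> R0 != 0 ->
  rankine_hugoniot pt c m q k R0 U0 E0 -> Sfun pt c m q k R0 = 0.
Proof.
move=> m0 R00 [mE qE kE].
have eE : energy c m q k R0 = end_energy R0 U0 E0.
  move: m0; rewrite /energy -kE -qE -mE mulf_eq0 negb_or => /andP[_ Uc0].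
  by rewrite /end_energy; field; rewrite R00 Uc0.
by rewrite /Sfun /pressure eE -qE -mE; field.
Qed.

Lemma derivable_Sfun (x : R) : x != 0 ->
  derivable (pressure pt c m q k) x 1 -> derivable (Sfun pt c m q k) x 1.
Proof.
move=> x0 dp.
have -> : Sfun pt c m q k
    = cst (q - m * c) - m ^+ 2 *: (fun y => y^-1) - pressure pt c m q k by [].
apply: derivableB dp; apply: derivableB; first exact: derivable_cst.
by apply: derivableZ; apply: derivableV.
Qed.

End Reduced.

(** * Profiles as solutions of a first-order autonomous equation *)

Section Profile.
Context {R : realType}.
Variables (pt : R -> R -> R) (c m q k alpha Rm Rs Rp : R) (Zm Zp : R -> R).

Lemma profile_surj (r : R -> R) :
  global_profile pt c m q k alpha Rm Rs Rp Zm Zp r ->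
  forall y, Rm < y < Rp -> exists x, r x = y.
Proof.
by move=> [rc _ _ [xs [_ _ [rm rp] _ _]]]; exact: continuous_surj_itv.
Qed.

(** Profiles increase, so the nonnegative root is the right one on both sides of [Rs]. *)
Definition speed (y : R) : R := Num.sqrt (if y < Rs then Zm y else Zp y).

Lemma profile_ode (r : R -> R) :
  global_profile pt c m q k alpha Rm Rs Rp Zm Zp r ->
  exists2 xs, r xs = Rs & forall x, x != xs -> is_derive x 1 r (speed (r x)).
Proof.
move=> [rc rinc _ [xs [[rxs [[dr _] _]] [Zl Zr] _ _ _]]].
exists xs => // x xxs.
have drx : derivable r x 1.
  by apply: dr; rewrite /= !in_itv/= andbT; apply/orP; rewrite -neq_lt.
suff <- : derive1 r x = speed (r x) by rewrite derive1E; exact: derivableP.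
have r'0 : 0 <= derive1 r x.
  have [xl|xl|/eqP] := ltgtP x xs; last by rewrite (negPf xxs).
  - apply: (@incr_derive1_ge0_itvNy _ r false xs) => [y|y z _ _|].
    + by rewrite inE => yl; apply: dr; left.
    + exact: rinc.
    + by rewrite in_itv.
  - apply: (@incr_derive1_ge0_itvy _ r false xs) => [y|y z _ _|].
    + by rewrite inE => yl; apply: dr; right.
    + exact: rinc.
    + by rewrite in_itv/= andbT.
(* A nonnegative slope is the square root of its square, which the profile prescribes. *)
rewrite /speed -[LHS]ger0_norm// -sqrtr_sqr.
have [xl|xl|/eqP] := ltgtP x xs; last by rewrite (negPf xxs).
- by rewrite Zl// -rxs rinc.
- by rewrite Zr// -rxs ltNge (ltW (rinc _ _ xl)).
Qed.

(** Each density in range is attained by [r], and there the canonical solution is a square. The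
    position of [Rs] relative to [Rm] and [Rp] is not fixed here, hence the separate bounds [y < Rp]
    and [Rm < y]. *)
Lemma profile_Z_ge0 (r : R -> R) :
  global_profile pt c m q k alpha Rm Rs Rp Zm Zp r ->
  (forall y, Rm < y < Rs -> y < Rp -> 0 <= Zm y) /\
  (forall y, Rs < y < Rp -> Rm < y -> 0 <= Zp y).
Proof.
move=> rP; have surj := profile_surj rP.
case: rP => _ rinc _ [xs [[rxs _] [Zl Zr] _ _ _]].
have rle : {mono r : x y / x <= y} := le_mono rinc.
split=> y /andP[ay yb] yR.
- have [|x rx] := surj y; first by rewrite ay.
  by rewrite -rx -Zl ?sqr_ge0// -(leW_mono rle) rx rxs.
- have [|x rx] := surj y; first by rewrite yR.
  by rewrite -rx -Zr ?sqr_ge0// -(leW_mono rle) rx rxs.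
Qed.

End Profile.

Theorem theorem4p9 (R : realType) (alpha : R) (pt : R -> R -> R)
  (c m q k : R) (Rm Rp Um Up Em Ep Rs : R) (Zm Zp : R -> R)
  (p := pressure pt c m q k) (S := Sfun pt c m q k)
  (alpha_gt0 : 0 < alpha)
  (pt_C2 : C2_on2 [set z : R * R | 0 < z.1] pt)
  (m_neq0 : m != 0)
  (Rm_gt0 : 0 < Rm) (Rp_gt0 : 0 < Rp)
  (RHm : rankine_hugoniot pt c m q k Rm Um Em)
  (RHp : rankine_hugoniot pt c m q k Rp Up Ep)
  (Rm_lt_Rp : Rm < Rp)
  (dp_ge0 : 0 <= derive1 p Rm /\ 0 <= derive1 p Rp)
  (lax_m : c < Um - Num.sqrt (derive1 p Rm))
  (lax_p : Up - Num.sqrt (derive1 p Rp) < c)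
  (p_C2 : C2_on `]0, +oo[ p)
  (convexity : (forall r, r \in `[Rm, Rp] -> convexityA pt c m q k r) \/
               (forall r, r \in `[Rm, Rp] -> convexityB pt c m q k r))
  (ddp_ge0 : forall r, 0 < r -> 0 <= derive1 (derive1 p) r)
  (Rs_in : Rm < Rs < Rp)
  (Rs_sonic : forall r, 0 < r -> (derive1 S r = 0 <-> r = Rs))
  (ddp_lipschitz :
     exists2 V : set R, nbhs Rs V & [lipschitz (derive1 (derive1 p) r) | r in V])
  (Zm_canonical : canonical_left pt c m q k alpha Rm Rs Zm)
  (Zp_canonical : canonical_right pt c m q k alpha Rs Rp Zp)
  (r rt : R -> R)
  (r_profile : global_profile pt c m q k alpha Rm Rs Rp Zm Zp r)
  (rt_profile : global_profile pt c m q k alpha Rm Rs Rp Zm Zp rt) :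
  (exists x0 : R, forall x, rt x = r (x - x0)) /\
  (r 0 = Rs -> rt 0 = Rs -> forall x, rt x = r x).
Proof.
have Rs_gt0 : 0 < Rs by case/andP: Rs_in => /(lt_trans Rm_gt0).
case/andP: (Rs_in) => RmRs RsRp.
have SRm : S Rm = 0 by apply: Sfun_end_state RHm => //; rewrite gt_eqF.
have SRp : S Rp = 0 by apply: Sfun_end_state RHp => //; rewrite gt_eqF.
have dS x : 0 < x -> derivable S x 1.
  move=> x0; apply: derivable_Sfun; first by rewrite gt_eqF.
  by case: p_C2 => [[dp _] _]; apply: dp; rewrite /= in_itv/= x0.
have S'_neq0 x : 0 < x -> x != Rs -> derive1 S x != 0.
  by move=> x0; apply: contra_neq => /Rs_sonic; exact.
have Q0 x : 0 < x -> x != Rs -> S x != 0 -> Qcoef pt c m q k alpha x != 0.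
  move=> x0 xs Sx; apply: mulf_neq0; apply: mulf_neq0 => //; rewrite invr_neq0//.
    by rewrite gt_eqF.
  exact: S'_neq0.
(* Only the open interval must avoid [Rs]; it is applied with an end state as one endpoint. *)
have S_neq a b : 0 < a -> a < b -> Rs \notin `]a, b[ -> S a != S b.
  move=> a0 ab Rsab; apply: (neq_of_derive_neq0 ab) => x xab.
  - by apply: dS; move: xab; rewrite in_itv/= => /andP[+ _]; exact: lt_le_trans.
  - apply: S'_neq0; last by apply: contraNneq Rsab => <-.
    by move: xab; rewrite in_itv/= => /andP[+ _]; exact: lt_trans.
have [Zm_ge0 Zp_ge0] := profile_Z_ge0 r_profile.
have Zm_gt0 x : x \in `]Rm, Rs[ -> 0 < Zm x.
  case: Zm_canonical => [[dZ _] _ ode _].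
  apply: (linear_ode_gt0 dZ ode) => y; rewrite in_itv/= => /andP[ly yl].
  - apply: Q0; [exact: lt_trans ly|by rewrite lt_eqF|].
    have := S_neq _ _ Rm_gt0 ly; rewrite SRm eq_sym; apply.
    by rewrite in_itv/= negb_and -!leNgt (ltW yl) orbT.
  - by apply: Zm_ge0; [rewrite ly|exact: lt_trans RsRp].
have Zp_gt0 x : x \in `]Rs, Rp[ -> 0 < Zp x.
  case: Zp_canonical => [[dZ _] _ ode _].
  apply: (linear_ode_gt0 dZ ode) => y; rewrite in_itv/= => /andP[ly yl].
  - have y0 := lt_trans Rs_gt0 ly; apply: Q0 => //; first by rewrite gt_eqF.
    have := S_neq _ _ y0 yl; rewrite SRp; apply.
    by rewrite in_itv/= negb_and -!leNgt (ltW ly).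
  - by apply: Zp_ge0; [rewrite ly|exact: lt_trans ly].
have rt_surj := profile_surj rt_profile.
have [xs rxs dr] := profile_ode r_profile.
have [xt rtxt drt] := profile_ode rt_profile.
case: r_profile => rc rinc rI _; case: rt_profile => rtc rtinc _ _.
have r_inj : injective r := inc_inj (le_mono rinc).
have rt_inj : injective rt := inc_inj (le_mono rtinc).
have rE x : r x = rt (x + (xt - xs)).
  apply: (autonomous_ode_translate (v := speed Rs Zm Zp)) => //.
  - by rewrite rxs.
  - by move=> y; exact: rt_surj.
  - move=> y ys; rewrite /speed sqrtr_eq0 -ltNge.
    have /andP[ly yl] := rI y.
    (* The case [r y = Rs] forces [y = xs] by injectivity. *)
    case: (ltgtP (r y) Rs) => ry; [apply: Zm_gt0|apply: Zp_gt0|];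
      rewrite ?in_itv/= ?ly ?ry//.
    by rewrite -rxs in ry; rewrite (r_inj _ _ ry) eqxx in ys.
split; first by exists (xt - xs) => x; rewrite rE subrK.
move=> r0 rt0 x; rewrite rE.
(* The phase condition places both sonic points at 0, so the shift vanishes. *)
have -> : xs = 0 by apply: r_inj; rewrite rxs.
have -> : xt = 0 by apply: rt_inj; rewrite rtxt.
by rewrite subrr addr0.
Qed.
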